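(* Let $X$ be a Baire space, let $T$ be a set, let $Y\subseteq [0,1]^T$ be a compact subspace, and let $\Sigma=\{x\in[0,1]^T: |\{t\in T: x(t)\neq 0\}|\le\aleph_0\}$. Let $f:X\times Y\to\mathbb R$ be a function which is continuous in the second variable, and let $B\subseteq Y\cap\Sigma$ be a set such that $Y=\overline{B}$ and, for every $b\in B$, the function $f_b:X\to\mathbb R$, $f_b(x)=f(x,b)$, is quasi-continuous. Then there exists a dense in $X$ $G_\delta$-set $A\subseteq X$ such that $f$ is jointly continuous at every point of $A\times Y$.
   Context: A topological space is Baire if every countable intersection of dense open subsets is dense. The cube $[0,1]^T$ carries the product topology. A mapping $g:X\to Z$ between topological spaces is quasi-continuous at $x_0\in X$ if for every neighborhood $U$ of $x_0$ in $X$ and every neighborhood $V$ of $g(x_0)$ in $Z$ there is a nonempty open in $X$ set $G\subseteq U$ with $g(G)\subseteq V$; $g$ is quasi-continuous if it is quasi-continuous at every point of $X$. ''$f$ is continuous in the second variable'' means that for every $x\in X$ the function $y\mapsto f(x,y)$ is continuous on $Y$. ''Jointly continuous at $(x,y)$'' means continuous at $(x,y)$ as a function on the product space $X\times Y$. *)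

(* Defs.v *)
From mathcomp Require Import all_boot all_order all_algebra.
From mathcomp Require Import boolp classical_sets functions cardinality.
From mathcomp Require Import set_interval reals topology normedtype sequences.
From mathcomp Require Import borel_hierarchy.

Set Implicit Arguments.
Unset Strict Implicit.
Unset Printing Implicit Defensive.

Import Order.TTheory GRing.Theory Num.Theory.
Import numFieldNormedType.Exports.

Local Open Scope classical_set_scope.
Local Open Scope ring_scope.

Definition baire_space (X : topologicalType) : Prop :=
  forall F : (set X)^nat,
    (forall i, open (F i) /\ dense (F i)) -> dense (\bigcap_i F i).

Definition quasi_continuous_at (X Z : topologicalType) (g : X -> Z) (x0 : X) :
    Prop :=
  forall (U : set X) (V : set Z), nbhs x0 U -> nbhs (g x0) V ->
    exists G : set X, [/\ open G, G !=set0, G `<=` U & g @` G `<=` V].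

Definition quasi_continuous (X Z : topologicalType) (g : X -> Z) : Prop :=
  forall x0 : X, quasi_continuous_at g x0.

Definition unit_interval (R : realType) : set R := `[0, 1].
Arguments unit_interval : clear implicits.

(* The product topology on [0, 1]^T, where [0, 1] is the sigma-type of the     *)
(* closed interval with its subspace topology.                                 *)
Notation cube R T := {ptws T -> set_type (unit_interval R)}.

Definition sigma_product (R : realType) (T : Type) : set (cube R T) :=
  [set x | countable [set t : T | \val (x t) != 0]].
Arguments sigma_product : clear implicits.

(* Main.v *)
Require Import Defs.
From mathcomp Require Import all_boot all_order all_algebra.
From mathcomp Require Import boolp classical_sets functions cardinality.
From mathcomp Require Import set_interval reals topology normedtype sequences.
From mathcomp Require Import borel_hierarchy.
From mathcomp Require Import lra.

(** Fix [e > 0].  It suffices that every nonempty open [W] contains a nonempty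
open [U] on which all the functions [f (_, y)], [y] in [Y], oscillate by at most
[e] simultaneously: the union of all such [U] is then open and dense, and at a
point of the intersection of these unions over [e = 1/(n+1)] the continuity of
[f (x, _)] makes [f] jointly continuous.  As [f] is continuous in the second
variable, only the [y] in the dense set [B] have to be watched.

Suppose that some [W] contains no such [U].  Given any neighbourhood [O] of the
diagonal of [Y * Y] and any nonempty open [U] inside [W], compactness provides a
finite subset of [B] that is [O]-dense, and quasi-continuity a smaller open set
on which the finitely many corresponding functions are almost constant.  The
large oscillation on it, of some [f (_, b)], then forces [f (_, b)] to be far
from [f (_, c)] on a whole nonempty open subset of [U], for a pair [(c, b)] that
lies in [O] ([separating_pair]).

This step is iterated, shrinking [U] and choosing [O] according to the pairs
found so far.  A decreasing sequence of open sets in a Baire space can have an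
empty intersection, so all the possible iterations are arranged into a tree
whose levels are disjoint families with dense union; a point lying in every
level selects a branch ([baire_tree]).  This yields a single [x] and pairs
[(c_n, b_n)] with [f (x, c_n)] and [f (x, b_n)] uniformly apart.

The hypothesis [B `<=` sigma_product R T] is what lets the neighbourhoods [O] be
chosen so that the pairs cluster only at the diagonal: the coordinates in the
countable supports of the points already used are listed, and the next pair must
agree up to [1/(n+1)] on the first [n] of each list, while on a coordinate
outside all the supports every pair agrees because both values are [0]
([countable_support_diagonal_strategy]).  A cluster point of the pairs, which
exists by compactness, is thus some [(y, y)], and this contradicts the
continuity of [f (x, _)] at [y]. *)

Set Implicit Arguments.
Unset Strict Implicit.
Unset Printing Implicit Defensive.

Import Order.TTheory GRing.Theory Num.Theory.
Import numFieldNormedType.Exports.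

Local Open Scope classical_set_scope.
Local Open Scope ring_scope.

(** * Branches of trees of open sets in Baire spaces *)

(** One half of Oxtoby's theorem on the Banach-Mazur game: in a Baire space, the
player who answers an open set [U] by a smaller [O s'] cannot always make the
intersection empty.  The states [s] carry the history of the play, and [step]
records the rule that the answers obey. *)
Lemma baire_tree (X : topologicalType) (S : Type) (O : S -> set X)
    (step : S -> S -> Prop) (s0 : S) :
  baire_space X -> open (O s0) -> O s0 !=set0 ->
  (forall s U, open U -> U !=set0 -> U `<=` O s -> U `<=` O s0 ->
     exists s', [/\ step s s', open (O s'), O s' !=set0 & O s' `<=` U]) ->
  exists (x : X) (u : nat -> S),
    u 0%N = s0 /\ forall n, step (u n) (u n.+1) /\ O (u n) x.
Proof.
move=> bX oO0 O0 next.
pose D s := [set s' | [/\ step s s', open (O s'), O s' !=set0 & O s' `<=` O s]].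
have /choice[E Emax] s : exists E, maximal_disjoint_subcollection O E (D s).
  by have [E ?] := ex_maximal_disjoint_subcollection O (D s); exists E.
(* [L n] is the n-th level of the tree; the sons of [s] form a maximal disjoint
   family of answers. *)
pose L := fix L n := if n is m.+1 then [set s' | exists2 s, L m s & E s s']
                     else [set s0].
have EsubD s s' : E s s' -> D s s' by have [+ _ _] := Emax s; apply.
have LO n s : L n s -> open (O s) /\ O s `<=` O s0.
  elim: n s => [s ->|n IH s' /= [s /IH[_ sub] /EsubD[_ ? _ sub']]].
    by split.
  by split => //; apply: subset_trans sub' sub.
(* Disjointness of the sons makes the node of level [n] over a point unique, so
   that nodes chosen separately for each [n] are consecutive. *)
have Luniq : forall n s t x, L n s -> L n t -> O s x -> O t x -> s = t.
  elim=> [s t x -> ->//|n IH s' t' x /= [s Ls Es] [t Lt Et] Osx Otx].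
  have [_ _ _ ss] := EsubD _ _ Es; have [_ _ _ tt] := EsubD _ _ Et.
  move: Et; rewrite -(IH s t x Ls Lt (ss _ Osx) (tt _ Otx)) => Et.
  by have [_ + _] := Emax s; apply => //; exists x.
(* An answer inside an open subset of [O s] that misses all the sons of [s]
   could be added to them. *)
have Ldense n U : open U -> U !=set0 -> U `<=` O s0 ->
    exists s, L n s /\ U `&` O s !=set0.
  elim: n U => [|n IH] U oU U0 UO0.
    exists s0; split => //; case: U0 => x Ux.
    by exists x; split => //; exact: UO0.
  have [s [Ls Us0]] := IH U oU U0 UO0; have [oOs _] := LO _ _ Ls.
  have oV : open (U `&` O s) by exact: openI.
  have [s' [st oOs' Os'0 Os'V]] := next s (U `&` O s) oV Us0 (@subIsetr _ _ _)
    (fun x Vx => UO0 _ Vx.1).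
  apply: contrapT => nU.
  have disj t x : E s t -> O t x -> O s' x -> False.
    move=> Et Otx /Os'V[Ux _]; apply: nU; exists t; split; last by exists x.
    by exists s.
  have nE : ~ E s s'.
    by case: Os'0 => z Oz Ess'; exact: (disj _ _ Ess' Oz Oz).
  have [sub tE maxE] := Emax s.
  apply: (maxE (s' |` E s)).
  - by split => [t|/(_ s' (or_introl erefl))//]; right.
  - move=> t [->|/sub//]; split => //.
    exact: subset_trans Os'V (@subIsetr _ _ _).
  - move=> a b [->|Ea] [->|Eb] // [x [Oa Ob]].
    + by case: (disj b x).
    + by case: (disj a x).
    + by apply: tE => //; exists x.
(* The levels are dense in [O s0] only; adding the exterior of [O s0] makes them
   dense in [X]. *)
pose F n := (\bigcup_(s in L n) O s) `|` ~` closure (O s0).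
have FG n : open (F n) /\ dense (F n).
  split.
    apply: openU; first by apply: bigcup_open => s /LO[].
    by apply: closed_openC; exact: closed_closure.
  move=> U U0 oU.
  have [[x [Ux O0x]]|nUO] := pselect (U `&` O s0 !=set0).
    have [||s [Ls [y [[Uy _] Oy]]]] := Ldense n (U `&` O s0) (openI oU oO0).
    + by exists x.
    + exact: subIsetr.
    by exists y; split => //; left; exists s.
  case: U0 => x Ux; exists x; split => //; right => /(_ U).
  have nU : nbhs x U by exact: open_nbhs_nbhs.
  by move=> /(_ nU); rewrite setIC.
have [x [O0x Fx]] := bX F FG _ O0 oO0.
have xL n : exists s, L n s /\ O s x.
  by have [[s Ls Osx]|/(_ (subset_closure O0x))//] := Fx n I; exists s.
have /choice[u uP] := xL.
exists x, u; split; first by have [] := uP 0%N.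
move=> n; have [Lu Oux] := uP n; split => //.
have [/= [s Ls Es] Ou'x] := uP n.+1.
have [st _ _ sub] := EsubD _ _ Es.
by rewrite (Luniq _ _ _ _ Lu Ls Oux (sub _ Ou'x)).
Qed.

(** * Pairs that are close in the compact space and separated by [f] *)

(** Near-covering form of the compactness argument: the property that [s] meets
the [O]-neighbourhood of [y'] holds for all [y'] near a given [y] and all large
enough finite subsets [s] of [B], hence for one [s] and all [y']. *)
Lemma finite_diagonal_net (K : topologicalType) (B : set K) (O : set (K * K)) :
  compact [set: K] -> dense B -> (forall y : K, nbhs (y, y) O) ->
  exists s : seq K, (forall b, b \in s -> B b) /\
    forall y, exists2 b, b \in s & O (b, y).
Proof.
move=> /compact_near_coveringP cK dB nO.
pose BS := [set s : seq K | forall b, b \in s -> B b].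
pose F := filter_from BS (fun s0 => [set s | BS s /\ {subset s0 <= s}]).
have FF : ProperFilter F.
  apply: filter_from_proper; last by move=> s Bs; exists s; split.
  apply: filter_from_filter; first by exists [::].
  move=> s t Bs Bt; exists (s ++ t).
    by move=> b; rewrite mem_cat => /orP[/Bs|/Bt].
  move=> r [Br sub]; split; split => // b bs; apply: sub; rewrite mem_cat bs //.
  by rewrite orbT.
have [|s0 Bs0 /(_ s0)] := cK _ F (fun s y => exists2 b, b \in s & O (b, y)) FF.
  move=> y _; have [[V1 V2] /= [nV1 nV2] VO] := nO y.
  have [b [ib Bb]] : V1° `&` B !=set0.
    by apply: dB; [exists y; exact: nbhs_singleton (nbhs_interior nV1)
                  |exact: open_interior].
  exists (V2, [set s | BS s /\ {subset [:: b] <= s}]) => /=.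
    by split => //; exists [:: b] => // c; rewrite inE => /eqP ->.
  move=> [z s] /= [V2z [_ bs]]; exists b; first by apply: bs; rewrite inE.
  by apply: VO; split => //=; exact: interior_subset.
move=> h; exists s0; split => // y.
exact: (h (conj Bs0 (fun _ bs => bs)) y I).
Qed.

(** Quasi-continuity is not stable under pairing of functions, but open sets can
be shrunk for one function after the other. *)
Lemma quasi_continuous_small_oscillation (R : realType) (X K : topologicalType)
    (g : K -> X -> R) (s : seq K) (U : set X) (e : R) :
  0 < e -> (forall b, b \in s -> quasi_continuous (g b)) ->
  open U -> U !=set0 ->
  exists V : set X, [/\ open V, V !=set0, V `<=` U &
    forall b x y, b \in s -> V x -> V y -> `|g b x - g b y| < e].
Proof.
move=> e0 + oU U0; elim: s => [|c s IH] qs; first by exists U; split.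
have [|V [oV [x Vx] VU Vs]] := IH.
  by move=> b bs; apply: qs; rewrite inE bs orbT.
have nV : nbhs x V by exact: open_nbhs_nbhs.
have e20 : 0 < e / 2 by rewrite divr_gt0.
have [|G [oG G0 GV Ge]] :=
    qs c _ x V (ball (g c x) (e / 2)) nV (nbhsx_ballx _ _ e20).
  by rewrite inE eqxx.
exists G; split => //; first exact: subset_trans VU.
move=> b y z; rewrite inE => /orP[/eqP -> Gy Gz|bs Gy Gz]; last first.
  by apply: Vs => //; exact: GV.
have /= : ball (g c x) (e / 2) (g c y) by apply: Ge; exists y.
have /= : ball (g c x) (e / 2) (g c z) by apply: Ge; exists z.
rewrite -!ball_normE /= distrC => hz hy; rewrite distrC in hy.
rewrite (splitr e); apply: le_lt_trans (ler_distD (g c x) _ _) _.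
by apply: ltrD => //; rewrite distrC.
Qed.

(** If no nonempty open subset of [U] controls the oscillation of all the
[f (_, b)], then a point [b] violating the bound and a point [c] of a finite net
that is close to [b] are separated on an open set.  The oscillation [e] is split
into seven parts: if [f (_, c)] varies by less than [e/7], then
[|f (z, b) - f (z, c)|] exceeds [3e/7] at one of the two points [z] that witness
the oscillation of [f (_, b)], and passing to an open set costs [e/7] for each
of the two functions. *)
Lemma separating_pair (R : realType) (X K : topologicalType) (B : set K)
    (f : X * K -> R) (O : set (K * K)) (U : set X) (e : R) :
  compact [set: K] -> dense B -> (forall y : K, nbhs (y, y) O) ->
  (forall b, B b -> quasi_continuous (fun x => f (x, b))) ->
  0 < e -> open U -> U !=set0 ->
  (forall V : set X, open V -> V !=set0 -> V `<=` U ->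
     exists x x' b, [/\ V x, V x', B b & e < `|f (x, b) - f (x', b)|]) ->
  exists (p : K * K) (G : set X), [/\ B p.1, B p.2 & O p] /\
    [/\ open G, G !=set0, G `<=` U &
        forall x, G x -> e / 7 < `|f (x, p.1) - f (x, p.2)|].
Proof.
move=> cK dB nO qf e0 oU U0 badU.
have d0 : 0 < e / 7 by rewrite divr_gt0.
have [s [sB sO]] := finite_diagonal_net cK dB nO.
have [V [oV V0 VU Vs]] := quasi_continuous_small_oscillation
  (g := fun b x => f (x, b)) (s := s) d0 (fun b bs => qf b (sB b bs)) oU U0.
have [x [x' [b [Vx Vx' Bb exx']]]] := badU V oV V0 VU.
have [c cs Ocb] := sO b.
have [z [Vz zcb]] : exists z, V z /\ 3 * (e / 7) < `|f (z, b) - f (z, c)|.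
  apply: contrapT => nz.
  have le z : V z -> `|f (z, b) - f (z, c)| <= 3 * (e / 7).
    by move=> Vz; rewrite leNgt; apply/negP => h; apply: nz; exists z.
  have := le _ Vx; have := le _ Vx'; have := Vs c x x' cs Vx Vx'.
  move: exx'; rewrite !ler_norml !ltr_norml lter_normr.
  move=> /orP[] ? /andP[? ?] /andP[? ?] /andP[? ?]; lra.
have [||G [oG G0 GV Gz]] := qf b Bb z V (ball (f (z, b)) (e / 7)).
- exact: open_nbhs_nbhs.
- exact: nbhsx_ballx.
exists (c, b), G; split; first by split => //; exact: sB.
split => //; first exact: subset_trans VU.
move=> t Gt /=.
have : ball (f (z, b)) (e / 7) (f (t, b)) by apply: Gz; exists t.
have := Vs c z t cs Vz (GV _ Gt).
rewrite -ball_normE /=; move: zcb; rewrite !ltr_norml !lter_normr.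
by move=> /orP[] ? /andP[? ?] /andP[? ?]; apply/orP; [right|left]; lra.
Qed.

(** * Neighbourhoods of the diagonal on which pairs cluster *)

(** A winning strategy in a form of Gruenhage's W-game at the diagonal of
[K * K], in which the opponent is restricted to pairs of points of [B]: [O s] is
the neighbourhood played after the pairs listed in [s]. *)
Definition diagonal_strategy (K : topologicalType) (B : set K)
    (O : seq (K * K) -> set (K * K)) : Prop :=
  (forall s (y : K), nbhs (y, y) (O s)) /\
  forall p : nat -> K * K,
    (forall n, [/\ B (p n).1, B (p n).2 & O (mkseq p n) (p n)]) ->
    cluster (p @ \oo) `<=` [set q | q.1 = q.2].

Lemma countable_enum (T : Type) (A : set T) : countable A ->
  exists e : nat -> option T, forall t, A t -> exists i, e i = Some t.
Proof.
move=> /countable_injP[g ginj].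
have /choice[e eP] i : exists o, forall t, A t -> g t = i -> o = Some t.
  have [[t [At gt]]|no] := pselect (exists t, A t /\ g t = i).
    by exists (Some t) => u Au gu; congr Some; apply: ginj; rewrite ?inE // gt.
  by exists None => t At gt; case: no; exists t.
by exists e => t At; exists (g t); exact: eP.
Qed.

Lemma near_all (Z I : Type) (F : set_system Z) (s : seq I)
    (P : I -> Z -> bool) : Filter F ->
  (forall i, \forall q \near F, P i q) -> \forall q \near F, all (P^~ q) s.
Proof.
move=> FF nP; elim: s => [|i s IH] /=; first exact: nearW.
by apply: filterS2 (nP i) IH => q -> ->.
Qed.

(** The [h t] serve as coordinates.  Closeness is imposed only on coordinates
listed so far, finitely many at each stage; every coordinate of a support is
eventually among them, and the remaining ones vanish on all the points played. *)
Lemma countable_support_diagonal_strategy (R : realType) (K : topologicalType)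
    (T : Type) (h : T -> K -> R) (B : set K) :
  (forall t, continuous (h t)) ->
  (forall y z, (forall t, h t y = h t z) -> y = z) ->
  (forall b, B b -> countable [set t | h t b != 0]) ->
  exists O, diagonal_strategy B O.
Proof.
move=> ch hsep cB.
have /choice[e eP] b : exists e : nat -> option T, B b ->
    forall t, h t b != 0 -> exists i, e i = Some t.
  have [/cB/countable_enum[e eP]|nB] := pselect (B b); first by exists e.
  by exists (fun=> None).
pose close (d : R) t (q : K * K) := `|h t q.1 - h t q.2| < d.
pose closeat n c i q := oapp (fun t => close n.+1%:R^-1 t q) true (e c i).
pose O s := [set q : K * K | all (fun c =>
  all (closeat (size s) c ^~ q) (iota 0 (size s))) (map fst s ++ map snd s)].
have nclose (d : R) t (y z : K) : 0 < d ->
    \forall q \near (y, z), `|h t q.1 - h t y| < d /\ `|h t q.2 - h t z| < d.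
  move=> d0.
  have hd u : nbhs u [set v | `|h t v - h t u| < d].
    have /cvgrPdist_lt/(_ d d0) := ch t u.
    by apply: filterS => v /=; rewrite distrC.
  by exists ([set v | `|h t v - h t y| < d], [set v | `|h t v - h t z| < d]).
exists O; split.
  move=> s y.
  have nat_at c i : \forall q \near (y, y), closeat (size s) c i q; last first.
    exact: (near_all _ _ (fun c => near_all _ _ (nat_at c))).
  rewrite /closeat; case: (e c i) => [t|]; last exact: (@nearW _ (nbhs (y, y))).
  have : 0 < (size s).+1%:R^-1 :> R by rewrite invr_gt0 ltr0n.
  move: _^-1 => d d0; have d20 : 0 < d / 2 by rewrite divr_gt0.
  apply: (@filterS _ (nbhs (y, y)) _ _ _ _ (nclose _ t y y d20)) => q [].
  rewrite /= /close !ltr_norml => /andP[? ?] /andP[? ?].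
  by apply/andP; split; lra.
move=> p pO [y z] yz /=; apply: hsep => t.
apply/eqP; rewrite -subr_eq0 -normr_le0; apply/ler_addgt0Pr => d d0.
have d3 : 0 < d / 3 by rewrite divr_gt0.
have [|[q1 q2] [/= cq [yq zq]]] :=
    yz (close (d / 3) t) _ _ (nclose _ t y z d3); last first.
  rewrite add0r; move: cq yq zq; rewrite /close ler_norml !ltr_norml /=.
  by move=> /andP[? ?] /andP[? ?] /andP[? ?]; apply/andP; split; lra.
suff : \forall n \near \oo, close (d / 3) t (p n) by [].
have [[k [i ki]]|no] := pselect (exists k i,
    e (p k).1 i = Some t \/ e (p k).2 i = Some t).
  near=> n.
  have kn : (k < n)%N by near: n; exact: nbhs_infty_gt.
  have iN : (i < n)%N by near: n; exact: nbhs_infty_gt.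
  have pk : p k \in mkseq p n by rewrite map_f // mem_iota.
  have [c cin ci] : exists2 c, c \in map fst (mkseq p n) ++ map snd (mkseq p n)
      & e c i = Some t.
    by case: ki => ci; [exists (p k).1|exists (p k).2] => //;
      rewrite mem_cat map_f // orbT.
  have [_ _ /allP/(_ c cin)/allP/(_ i)] := pO n.
  rewrite size_mkseq mem_iota iN => /(_ isT); rewrite /closeat ci /= => hc.
  apply: lt_le_trans hc _; apply: ltW.
  near: n; exact: (near_infty_natSinv_lt (interval_inference.PosNum d3)).
apply: nearW => n; rewrite /close.
have [B1 B2 _] := pO n.
have h1 : h t (p n).1 = 0.
  apply/eqP; apply: contrapT => /negP/(eP _ B1)[i ei].
  by apply: no; exists n, i; left.
have h2 : h t (p n).2 = 0.
  apply/eqP; apply: contrapT => /negP/(eP _ B2)[i ei].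
  by apply: no; exists n, i; right.
by rewrite /= h1 h2 subrr normr0.
Unshelve. all: by end_near. Qed.

(** * Joint continuity *)

(** The core of the proof: otherwise [separating_pair] applies at every stage of
a play of [baire_tree] whose states are an open set together with the list of
the pairs found so far. *)
Lemma baire_small_oscillation (R : realType) (X K : topologicalType) (B : set K)
    (f : X * K -> R) (O : seq (K * K) -> set (K * K)) (W : set X) (e : R) :
  baire_space X -> compact [set: K] -> dense B -> diagonal_strategy B O ->
  (forall x, continuous (fun y => f (x, y))) ->
  (forall b, B b -> quasi_continuous (fun x => f (x, b))) ->
  open W -> W !=set0 -> 0 < e ->
  exists U : set X, [/\ open U, U !=set0, U `<=` W &
    forall x x' y, U x -> U x' -> `|f (x, y) - f (x', y)| <= e].
Proof.
move=> bX cK dB [nO OK] cf qf oW W0 e0; apply: contrapT => noU.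
have fnear x y d : 0 < d -> nbhs y [set u | `|f (x, u) - f (x, y)| < d].
  move=> d0; have /cvgrPdist_lt/(_ d d0) := cf x y.
  by apply: filterS => v /=; rewrite distrC.
have badW V : open V -> V !=set0 -> V `<=` W ->
    exists x x' b, [/\ V x, V x', B b & e < `|f (x, b) - f (x', b)|].
  move=> oV V0 VW; apply: contrapT => nV; apply: noU; exists V; split => //.
  move=> x x' y Vx Vx'; apply/ler_addgt0Pr => d d0.
  have d20 : 0 < d / 2 by rewrite divr_gt0.
  have [|| b [/interior_subset[bx bx'] Bb]] := dB
    ([set u | `|f (x, u) - f (x, y)| < d / 2] `&`
     [set u | `|f (x', u) - f (x', y)| < d / 2])°.
  - by exists y; apply: nbhs_singleton; apply: nbhs_interior; apply: filterI;
      exact: fnear.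
  - exact: open_interior.
  have : `|f (x, b) - f (x', b)| <= e.
    by rewrite leNgt; apply/negP => h; apply: nV; exists x, x', b.
  move: bx bx' => /=; rewrite !ler_norml !ltr_norml.
  by move=> /andP[? ?] /andP[? ?] /andP[? ?]; apply/andP; split; lra.
pose step (s s' : set X * seq (K * K)) := exists p, [/\ s'.2 = rcons s.2 p,
  B p.1, B p.2, O s.2 p &
  forall x, s'.1 x -> e / 7 < `|f (x, p.1) - f (x, p.2)|].
have [//|//||x [u [u0 uP]]] := @baire_tree X _ fst step (W, [::]) bX.
  move=> [V s] U oU U0 _ UW.
  have [p [G [[B1 B2 Op] [oG G0 GU Gp]]]] :=
    separating_pair cK dB (nO s) qf e0 oU U0
    (fun V oV V0 VU => badW V oV V0 (subset_trans VU UW)).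
  by exists (G, rcons s p); split => //; exists p.
have /choice[p pP] n := (uP n).1.
have up n : (u n).2 = mkseq p n.
  elim: n => [|n IH]; first by rewrite u0.
  by have [-> _ _ _ _] := pP n; rewrite IH mkseqS.
have pB n : [/\ B (p n).1, B (p n).2 & O (mkseq p n) (p n)].
  by have [_ ? ? ? _] := pP n; rewrite -up.
have psep n : e / 7 < `|f (x, (p n).1) - f (x, (p n).2)|.
  by have [_ _ _ _] := pP n; apply; exact: (uP n.+1).2.
have pT : (p @ \oo) ([set: K] `*` [set: K]) by exact: (@nearW _ \oo).
have [[y z] [_ yz]] := compact_setX cK cK _ pT.
have /= yEz := OK p pB _ yz; rewrite -{z}yEz in yz.
have d0 : 0 < e / 7 / 2 by rewrite !divr_gt0.
pose N := [set v | `|f (x, v) - f (x, y)| < e / 7 / 2].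
have nN : nbhs (y, y) (N `*` N) by exists (N, N) => //; split; exact: fnear.
have [|[q1 q2] [/= + [/= h1 h2]]] :=
    yz [set q | e / 7 < `|f (x, q.1) - f (x, q.2)|] _ _ nN.
  by apply: (@nearW _ \oo) => n; exact: psep.
move: h1 h2; rewrite /N /= !ltr_norml lter_normr.
by move=> /andP[? ?] /andP[? ?] /orP[]; lra.
Qed.

Lemma joint_continuity_residual (R : realType) (X K : topologicalType)
    (B : set K) (f : X * K -> R) (O : seq (K * K) -> set (K * K)) :
  baire_space X -> compact [set: K] -> dense B -> diagonal_strategy B O ->
  (forall x, continuous (fun y => f (x, y))) ->
  (forall b, B b -> quasi_continuous (fun x => f (x, b))) ->
  exists A : set X, [/\ dense A, Gdelta A &
    forall x y, A x -> {for (x, y), continuous f}].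
Proof.
move=> bX cK dB OB cf qf.
pose small n := [set U : set X | open U /\
  forall x x' y, U x -> U x' -> `|f (x, y) - f (x', y)| <= n.+1%:R^-1].
pose F n := \bigcup_(U in small n) U.
have oF n : open (F n) by apply: bigcup_open => U [].
have dF n : dense (F n).
  move=> W W0 oW.
  have [|U [oU [x Ux] UW Us]] :=
      baire_small_oscillation (e := n.+1%:R^-1) bX cK dB OB cf qf oW W0.
    by rewrite invr_gt0 ltr0n.
  by exists x; split; [exact: UW|exists U].
exists (\bigcap_n F n); split; first by apply: bX => n.
  by exists F.
move=> x y Ax; apply/cvgrPdist_lt => d d0.
have d20 : 0 < d / 2 by rewrite divr_gt0.
have [n nd] : exists n, n.+1%:R^-1 < d / 2.
  have [n _ nP] := near_infty_natSinv_lt (interval_inference.PosNum d20).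
  by exists n; exact: (nP n (leqnn n)).
have [U [oU Us] Ux] := Ax n I.
have /cvgrPdist_lt/(_ _ d20) nV := cf x y.
exists (U, [set v | `|f (x, y) - f (x, v)| < d / 2]) => /=.
  by split => //; exact: open_nbhs_nbhs.
move=> [x' v] /= [Ux' yv]; rewrite (splitr d).
apply: le_lt_trans (ler_distD (f (x, v)) _ _) _.
by apply: ltrD => //; exact: le_lt_trans (Us _ _ _ Ux Ux') nd.
Qed.

(** * Subspaces of the cube *)

Lemma compact_set_type (Z : topologicalType) (Y : set Z) :
  compact Y -> compact [set: set_type Y].
Proof.
move=> cY F FF _.
have [|y [Yy Fy]] := cY (\val @ F) _.
  by apply: (@filterE _ F) => a; exact: set_valP.
exists (exist _ y (mem_set Yy)); split => // A V FA [V' [[W oW <-] Wy] WV].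
have [|_ [[a Aa <-] Wa]] := Fy (\val @` A) W _ (open_nbhs_nbhs (conj oW Wy)).
  by apply: (@filterS _ F _ A) => // a Aa; exists a.
by exists a; split => //; exact: WV.
Qed.

Lemma eval_continuous (T : Type) (Z : topologicalType) (t : T) :
  continuous (fun u : {ptws T -> Z} => u t).
Proof.
move=> u; have /cvg_sup/(_ t) ut : nbhs u --> u by exact: cvg_id.
move=> U nU; apply: ut.
exact: (@initial_continuous _ _ (fun v : {ptws T -> Z} => v t) u U nU).
Qed.

Theorem theorem3p1 (R : realType) (X : topologicalType) (T : Type)
    (Y B : set (cube R T)) (f : X * set_type Y -> R) :
  baire_space X ->
  compact Y ->
  (forall x : X, continuous (fun y : set_type Y => f (x, y))) ->
  B `<=` Y `&` sigma_product R T ->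
  Y = closure B ->
  (forall b : set_type Y, B (\val b) ->
     quasi_continuous (fun x : X => f (x, b))) ->
  exists A : set X,
    [/\ dense A, Gdelta A &
        forall (x : X) (y : set_type Y), A x -> {for (x, y), continuous f}].
Proof.
move=> bX cY cf BY YB qf.
pose h (t : T) (y : set_type Y) : R := \val (\val y t).
have cK : compact [set: set_type Y] by exact: compact_set_type.
have dB : dense [set b : set_type Y | B (\val b)].
  move=> U [y Uy] [V oV VU]; rewrite -VU in Uy *.
  have : closure B (\val y) by rewrite -YB; exact: set_valP.
  move=> /(_ V) [|b [Bb Vb]]; first exact: open_nbhs_nbhs.
  have [Yb _] := BY _ Bb.
  by exists (exist _ b (mem_set Yb)).
have [||b /BY[_ //]|O OB] := @countable_support_diagonal_strategy
    R (set_type Y) T h [set b | B (\val b)].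
- have valY : continuous (\val : set_type Y -> cube R T).
    move=> y.
    exact: (@initial_continuous _ _ (set_val : set_type Y -> cube R T)).
  have valI : continuous (\val : set_type (unit_interval R) -> R).
    move=> u.
    exact: (@initial_continuous _ _
              (set_val : set_type (unit_interval R) -> R)).
  move=> t y.
  exact: (continuous_comp (valY y)
           (continuous_comp (@eval_continuous _ _ t _) (valI _))).
- move=> y z hyz; apply: val_inj; apply: funext => t; apply: val_inj.
  exact: hyz.
exact: joint_continuity_residual bX cK dB OB cf qf.
Qed.
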